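(* Let $\ell,r\in\overline{\mathbb N}_0$. The set $\Sigma_{\ell,r}$ of smooth step functions of orders $\ell$ and $r$ is closed under both multiplication and composition of functions.
   Context: $\overline{\mathbb N}_0=\{0,1,2,\dots\}\cup\{\infty\}$. When an order equals $\infty$, the corresponding conditions are understood to hold for every finite derivative order. $C^\infty[0,1]$ denotes real-valued infinitely differentiable functions on $[0,1]$ (one-sided derivatives at endpoints). A smooth step function of orders $\ell$ and $r$ is a strictly increasing function $\sigma:[0,1]\to[0,1]$, $\sigma\in C^\infty[0,1]$, with $\sigma(0)=0$, $\sigma(1)=1$, and with flat ends of orders $\ell$ and $r$, i.e. $\sigma^{(j)}(0)=0$ for $j=1,\dots,\ell$ and $\sigma^{(k)}(1)=0$ for $k=1,\dots,r$ (a condition of order $0$ being vacuous). $\Sigma_{\ell,r}$ denotes the family of all such functions. *)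

(* Defs.v *)
From mathcomp Require Import all_boot all_order all_algebra.
From mathcomp Require Import all_classical all_reals all_analysis.
Set Implicit Arguments.
Unset Strict Implicit.
Unset Printing Implicit Defensive.
Import Order.TTheory GRing.Theory Num.Theory.
Import numFieldNormedType.Exports.
Local Open Scope classical_set_scope.
Local Open Scope ring_scope.

(* A function on [0, 1] is represented by an arbitrary extension R -> R. All
   notions below depend only on its values on [0, 1]: difference quotients are
   taken along points y of [0, 1] with y != x, so that derivatives at 0 and 1
   are one-sided. *)
Section UnitIntervalCalculus.
Context {R : realType}.
Implicit Types (f : R -> R) (x : R).

Definition derivable01 f x : Prop :=
  cvg ((f y - f x) / (y - x) @[y --> within `[0, 1] x^']).

Definition derive01 f x : R :=
  lim ((f y - f x) / (y - x) @[y --> within `[0, 1] x^']).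

Definition derive01n (n : nat) f : R -> R := iter n derive01 f.

Definition smooth01 f : Prop :=
  forall n x, x \in `[0, 1] -> derivable01 (derive01n n f) x.

End UnitIntervalCalculus.

(* The order None stands for infinity. *)
Definition order_ext : Type := option nat.

Definition le_order (j : nat) (l : order_ext) : bool :=
  if l is Some n then (j <= n)%N else true.

Record smooth_step {R : realType} (l r : order_ext) (f : R -> R) : Prop :=
  SmoothStep {
    step_fun : set_fun `[0, 1] `[0, 1] f;
    step_incr : {in `[0, 1] &, {homo f : x y / x < y}};
    step_smooth : smooth01 f;
    step_at0 : f 0 = 0;
    step_at1 : f 1 = 1;
    step_flat0 : forall j, (1 <= j)%N -> le_order j l -> derive01n j f 0 = 0;
    step_flat1 : forall k, (1 <= k)%N -> le_order k r -> derive01n k f 1 = 0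
  }.

Definition Sigma (R : realType) (l r : order_ext) : set (R -> R) :=
  [set f | smooth_step l r f].

(* Main.v *)
Require Import Defs.
From mathcomp Require Import all_boot all_order all_algebra.
From mathcomp Require Import all_classical all_reals all_analysis.
Set Implicit Arguments.
Unset Strict Implicit.
Unset Printing Implicit Defensive.
Import Order.TTheory GRing.Theory Num.Theory.
Import numFieldNormedType.Exports.
Local Open Scope classical_set_scope.
Local Open Scope ring_scope.

(** Range, monotonicity and end values of [f \* g] and [f \o g] are immediate;
    the content is smoothness and flatness.  Both follow from the two
    first-order rules [(f g)' = f' g + f g'] and [(f o g)' = (f' o g) g'] on
    [[0, 1]].

    Smoothness is proved order by order: being [n] times differentiable
    ([diff01 n]) is stable under sums, products and composition by induction
    on [n], since the rules express the derivative of a compound by compounds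
    of functions that are [n - 1] times differentiable.

    Flatness is obtained without expanding higher derivatives.  Flatness of [f]
    to order [m] at an end point [a] says that [f'] vanishes at [a] to order
    [m], and the smooth functions vanishing at [a] to order [m] form an ideal of
    the ring of smooth functions ([vanish01D], [vanish01Ml], [vanish01Mr]).  The
    right-hand sides of the product and chain rules visibly lie in that ideal;
    for the composition, the factor [g'] alone is responsible for it.

    First-order differentiability is handled in Caratheodory's form: [f] has
    derivative [d] at [x] when [f y - f x = q y * (y - x)] on [[0, 1]] for some
    [q] tending to [d] at [x].  Both rules are then algebra on the [q]'s, and
    the chain rule needs no case distinction on [g y = g x]. *)

Section UnitIntervalCalculusTheory.
Context {R : realType}.
Implicit Types (f g q : R -> R) (x y a d : R) (n m : nat).

Local Notation I := (`[0, 1] : interval R).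

(** * First-order differentiation on the unit interval *)

(** Points of [[0, 1]] are not isolated in it, so a derivative, as a limit of
    difference quotients, is unique. *)
Lemma dnbhs01_proper x : x \in I -> ProperFilter (within `[0, 1] x^').
Proof.
rewrite in_itv /= => /andP[x0 x1].
apply: Build_ProperFilter_ex => A xA.
have xA' : \forall y \near x, y != x -> 0 <= y <= 1 -> A y.
  have xA' : nbhs x (fun y => y != x -> y \in I -> A y) := xA.
  apply: filterS xA' => y yA yx yI.
  by apply: yA => //=; rewrite in_itv.
(* Approach x from the right, except at 1, where only the left is available. *)
have [xlt1|xge1] := ltP x 1.
  near x^'+ => y; exists y.
  have xy : x < y by near: y; exact: nbhs_right_gt.
  suff : y != x -> 0 <= y <= 1 -> A y.
    apply; first by rewrite gt_eqF.
    rewrite (le_trans x0 (ltW xy)) /=.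
    by near: y; exact: nbhs_right_le.
  by near: y; exact: cvg_within xA'.
near x^'- => y; exists y.
have yx : y < x by near: y; exact: nbhs_left_lt.
suff : y != x -> 0 <= y <= 1 -> A y.
  apply; first by rewrite lt_eqF.
  rewrite (le_trans (ltW yx) x1) andbT.
  by near: y; apply: nbhs_left_ge; exact: lt_le_trans xge1.
by near: y; exact: cvg_within xA'.
Unshelve. all: by end_near. Qed.

(** Caratheodory's form of differentiability.  The limit of [q] is not
    punctured, which is what makes it usable along [g] in the chain rule. *)
Definition has_derive01 f x d : Prop :=
  exists2 q, q y @[y --> within `[0, 1] (nbhs x)] --> d
           & {in I, forall y, f y - f x = q y * (y - x)}.

Lemma has_derive01P f x d : x \in I ->
  has_derive01 f x d <->
  ((f y - f x) / (y - x) @[y --> within `[0, 1] x^'] --> d).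
Proof.
move=> xI; split=> [[q qd fq]|fd].
  have : q y @[y --> within `[0, 1] x^'] --> d.
    apply: cvg_trans qd; apply: cvg_app.
    move=> A xA; have xA' : nbhs x (fun y => y \in I -> A y) := xA.
    by apply: filterS xA' => y + _.
  apply: cvg_trans; apply: near_eq_cvg.
  rewrite near_withinE /=; near=> y => yI.
  rewrite fq // mulfK // subr_eq0.
  by near: y; exact: nbhs_dnbhs_neq.
(* The value d at x extends the difference quotient continuously, as required
   by the limit that is not punctured. *)
exists (fun y => if y == x then d else (f y - f x) / (y - x)); last first.
  move=> y yI; case: eqVneq => [->|yx]; first by rewrite !subrr mulr0.
  by rewrite divfK// subr_eq0.
move=> A dA.
have xA : nbhs x (fun y => y != x -> y \in I -> A ((f y - f x) / (y - x))).
  exact: fd A dA.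
apply: filterS xA => y /= Ay yI.
case: eqVneq => [_|yx]; first exact: nbhs_singleton.
exact: Ay.
Unshelve. all: by end_near. Qed.

Lemma derivable01P f x : x \in I ->
  derivable01 f x -> has_derive01 f x (derive01 f x).
Proof. by move=> xI fx; apply/has_derive01P. Qed.

Lemma has_derive01_derivable f x d : x \in I ->
  has_derive01 f x d -> derivable01 f x.
Proof. by move=> xI /has_derive01P-/(_ xI) fd; apply: cvgP fd. Qed.

Lemma has_derive01_val f x d : x \in I ->
  has_derive01 f x d -> derive01 f x = d.
Proof.
move=> xI /has_derive01P-/(_ xI) fd.
have := dnbhs01_proper xI => ?; exact: cvg_lim fd.
Qed.

Lemma has_derive01_cvg f x d : has_derive01 f x d ->
  f y @[y --> within `[0, 1] (nbhs x)] --> f x.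
Proof.
move=> [q qd fq].
have -> : f x = d * (x - x) + f x by rewrite subrr mulr0 add0r.
have : q y * (y - x) + f x @[y --> within `[0, 1] (nbhs x)]
    --> d * (x - x) + f x.
  apply: cvgD; last exact: cvg_cst.
  apply: cvgM => //; apply: cvgB; last exact: cvg_cst.
  exact/cvg_within.
apply: cvg_trans; apply: near_eq_cvg.
by rewrite near_withinE; near=> y => yI; rewrite -fq // subrK.
Unshelve. all: by end_near. Qed.

Lemma eq_has_derive01 f g x d : x \in I -> {in I, f =1 g} ->
  has_derive01 f x d -> has_derive01 g x d.
Proof.
by move=> xI fg [q qd fq]; exists q => // y yI; rewrite -!fg // fq.
Qed.

Lemma has_derive01D f g x df dg :
  has_derive01 f x df -> has_derive01 g x dg ->
  has_derive01 (f \+ g) x (df + dg).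
Proof.
move=> [q qd fq] [p pd gp]; exists (q \+ p); first exact: cvgD.
by move=> y yI /=; rewrite mulrDl -fq // -gp // opprD addrACA.
Qed.

Lemma has_derive01M f g x df dg :
  has_derive01 f x df -> has_derive01 g x dg ->
  has_derive01 (f \* g) x (df * g x + f x * dg).
Proof.
move=> [q qd fq] gd; have gx := has_derive01_cvg gd.
case: gd => p pd gp; exists (fun y => q y * g y + f x * p y).
  by apply: cvgD; apply: cvgM => //; exact: cvg_cst.
move=> y yI /=.
rewrite mulrDl -(mulrA (f x)) -gp // mulrAC -fq //.
by rewrite mulrBl mulrBr addrA subrK.
Qed.

Lemma has_derive01_comp f g x df dg : set_fun `[0, 1] `[0, 1] g ->
  has_derive01 f (g x) df -> has_derive01 g x dg ->
  has_derive01 (f \o g) x (df * dg).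
Proof.
move=> g01 [q qd fq] gd; have gx := has_derive01_cvg gd.
case: gd => p pd gp; exists (fun y => q (g y) * p y).
  apply: cvgM => //; apply: cvg_comp qd => A /= gA.
  have xA : nbhs x (fun y => y \in I -> g y \in I -> A (g y)) := gx _ gA.
  by apply: filterS xA => y /= + yI; apply => //; exact: g01.
by move=> y yI /=; rewrite fq ?gp ?mulrA //; exact: g01.
Qed.

Lemma eq_derivable01 f g x : x \in I -> {in I, f =1 g} ->
  derivable01 f x -> derivable01 g x.
Proof.
move=> xI fg /(derivable01P xI) fd.
exact: has_derive01_derivable (eq_has_derive01 xI fg fd).
Qed.

Lemma eq_derive01 f g : {in I, f =1 g} -> {in I, derive01 f =1 derive01 g}.
Proof.
move=> fg x xI; congr (lim _).
by apply/seteqP; split; apply: near_eq_cvg; rewrite near_withinE;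
  near=> y => yI; rewrite !fg.
Unshelve. all: by end_near. Qed.

(** * Functions differentiable a given number of times *)

Definition diff01 n f : Prop :=
  forall k, (k < n)%N -> {in I, forall x, derivable01 (derive01n k f) x}.

Lemma diff01S n f :
  diff01 n.+1 f <->
  {in I, forall x, derivable01 f x} /\ diff01 n (derive01 f).
Proof.
split=> [fn|[f1 fn] [|k] kn]; last 2 first.
- exact: f1.
- by rewrite /derive01n iterSr; exact: fn.
by split=> [|k kn]; [exact: (fn 0)|have := fn k.+1 kn; rewrite /derive01n iterSr].
Qed.

Lemma diff01W n f : diff01 n.+1 f -> diff01 n f.
Proof. by move=> fn k kn; apply: fn; exact: ltnW. Qed.

Lemma smooth01P f : smooth01 f <-> forall n, diff01 n f.
Proof.
split=> [fs n k _ x|fs n x]; [exact: fs|exact: (fs n.+1 n)].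
Qed.

Lemma eq_diff01 n f g : {in I, f =1 g} -> diff01 n f -> diff01 n g.
Proof.
elim: n f g => [//|n IHn] f g fg /diff01S[f1 fn]; apply/diff01S; split.
  by move=> x xI; exact: eq_derivable01 (f1 _ xI).
exact: IHn (eq_derive01 fg) fn.
Qed.

Lemma diff01_rec n f (f' : R -> R) :
  {in I, forall x, has_derive01 f x (f' x)} -> diff01 n f' -> diff01 n.+1 f.
Proof.
move=> fd f'n; apply/diff01S; split.
  by move=> x xI; exact: has_derive01_derivable (fd x xI).
by apply: eq_diff01 f'n => x xI; rewrite (has_derive01_val xI (fd x xI)).
Qed.

Lemma diff01D n f g : diff01 n f -> diff01 n g -> diff01 n (f \+ g).
Proof.
elim: n f g => [//|n IHn] f g /diff01S[f1 fn] /diff01S[g1 gn].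
apply: (@diff01_rec _ _ (derive01 f \+ derive01 g)); last exact: IHn.
move=> x xI.
by apply: has_derive01D; apply: derivable01P => //; [exact: f1|exact: g1].
Qed.

Lemma diff01M n f g : diff01 n f -> diff01 n g -> diff01 n (f \* g).
Proof.
elim: n f g => [//|n IHn] f g fS gS.
have [[f1 fn] [g1 gn]] := ((diff01S _ _).1 fS, (diff01S _ _).1 gS).
apply: (@diff01_rec _ _ (derive01 f \* g \+ f \* derive01 g)).
  move=> x xI; apply: has_derive01M; apply: derivable01P => //.
    exact: f1.
  exact: g1.
by apply: diff01D; apply: IHn => //; exact: diff01W.
Qed.

Lemma diff01_comp n f g : set_fun `[0, 1] `[0, 1] g ->
  diff01 n f -> diff01 n g -> diff01 n (f \o g).
Proof.
move=> g01; elim: n f => [//|n IHn] f fS gS.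
have [[f1 fn] [g1 gn]] := ((diff01S _ _).1 fS, (diff01S _ _).1 gS).
apply: (@diff01_rec _ _ ((derive01 f \o g) \* derive01 g)).
  move=> x xI; apply: has_derive01_comp => //; apply: derivable01P => //.
  - exact: g01.
  - by apply: f1; exact: g01.
  - exact: g1.
by apply: diff01M gn; exact: IHn fn (diff01W gS).
Qed.

(** * Smooth functions *)

Lemma smooth01_has_derive f x : smooth01 f -> x \in I ->
  has_derive01 f x (derive01 f x).
Proof. by move=> fs xI; apply: derivable01P => //; exact: (fs 0). Qed.

Lemma smooth01_derive f : smooth01 f -> smooth01 (derive01 f).
Proof. by move=> fs n x xI; have := fs n.+1 x xI; rewrite /derive01n iterSr. Qed.

Lemma smooth01M f g : smooth01 f -> smooth01 g -> smooth01 (f \* g).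
Proof.
by move=> /smooth01P fs /smooth01P gs; apply/smooth01P => n; exact: diff01M.
Qed.

Lemma smooth01_comp f g : set_fun `[0, 1] `[0, 1] g ->
  smooth01 f -> smooth01 g -> smooth01 (f \o g).
Proof.
move=> g01 /smooth01P fs /smooth01P gs.
by apply/smooth01P => n; exact: diff01_comp.
Qed.

Lemma derive01D f g : smooth01 f -> smooth01 g ->
  {in I, derive01 (f \+ g) =1 derive01 f \+ derive01 g}.
Proof.
move=> fs gs x xI; apply: has_derive01_val => //.
by apply: has_derive01D; exact: smooth01_has_derive.
Qed.

Lemma derive01M f g : smooth01 f -> smooth01 g ->
  {in I, derive01 (f \* g) =1 derive01 f \* g \+ f \* derive01 g}.
Proof.
move=> fs gs x xI; apply: has_derive01_val => //.
by apply: has_derive01M; exact: smooth01_has_derive.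
Qed.

Lemma derive01_comp f g : set_fun `[0, 1] `[0, 1] g ->
  smooth01 f -> smooth01 g ->
  {in I, derive01 (f \o g) =1 (derive01 f \o g) \* derive01 g}.
Proof.
move=> g01 fs gs x xI; apply: has_derive01_val => //.
apply: has_derive01_comp => //; apply: smooth01_has_derive => //.
exact: g01.
Qed.

(** * The ideal of smooth functions vanishing to a given order *)

Definition vanish01 m a f : Prop :=
  forall j, (j < m)%N -> derive01n j f a = 0.

Lemma vanish01S m a f :
  vanish01 m.+1 a f <-> f a = 0 /\ vanish01 m a (derive01 f).
Proof.
split=> [fm|[f0 fm] [|j] jm //]; last by rewrite /derive01n iterSr; exact: fm.
split=> [|j jm]; first exact: (fm 0).
by have := fm j.+1 jm; rewrite /derive01n iterSr.
Qed.

Lemma vanish01W m a f : vanish01 m.+1 a f -> vanish01 m a f.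
Proof. by move=> fm j jm; apply: fm; exact: ltnW. Qed.

Lemma eq_vanish01 m a f g : a \in I -> {in I, f =1 g} ->
  vanish01 m a f -> vanish01 m a g.
Proof.
move=> aI; elim: m f g => [//|m IHm] f g fg /vanish01S[f0 fm].
apply/vanish01S; split; first by rewrite -fg.
exact: IHm (eq_derive01 fg) fm.
Qed.

Lemma vanish01D m a f g : a \in I -> smooth01 f -> smooth01 g ->
  vanish01 m a f -> vanish01 m a g -> vanish01 m a (f \+ g).
Proof.
move=> aI; elim: m f g => [//|m IHm] f g fs gs.
move=> /vanish01S[f0 fm] /vanish01S[g0 gm].
apply/vanish01S; split; first by rewrite /= f0 g0 addr0.
apply: (eq_vanish01 aI (f := derive01 f \+ derive01 g)).
  by move=> x xI; rewrite derive01D.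
by apply: IHm => //; exact: smooth01_derive.
Qed.

(** In [f' g + f g'] the factor [f'] vanishes to one order less than [f], which
    is the order left to prove, and the factor [f] does so a fortiori. *)
Lemma vanish01Ml m a f g : a \in I -> smooth01 f -> smooth01 g ->
  vanish01 m a f -> vanish01 m a (f \* g).
Proof.
move=> aI; elim: m f g => [//|m IHm] f g fs gs fS.
have [f0 fm] := (vanish01S _ _ _).1 fS.
apply/vanish01S; split; first by rewrite /= f0 mul0r.
have [f's g's] := (smooth01_derive fs, smooth01_derive gs).
apply: (eq_vanish01 aI (f := derive01 f \* g \+ f \* derive01 g)).
  by move=> x xI; rewrite derive01M.
apply: vanish01D => //; [exact: smooth01M|exact: smooth01M|exact: IHm|].
by apply: IHm => //; exact: vanish01W.
Qed.

Lemma vanish01Mr m a f g : a \in I -> smooth01 f -> smooth01 g ->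
  vanish01 m a g -> vanish01 m a (f \* g).
Proof.
move=> aI fs gs gm; apply: (eq_vanish01 aI (f := g \* f)).
  by move=> x _ /=; rewrite mulrC.
exact: vanish01Ml.
Qed.

(** * Flat points *)

(** The common form of the two end conditions of a smooth step function. *)
Definition flat01 (l : order_ext) a f : Prop :=
  forall j, (1 <= j)%N -> le_order j l -> derive01n j f a = 0.

(** Restating flatness as a vanishing condition on the derivative brings the
    ideal property to bear on the product and chain rules. *)
Lemma flat01P l a f :
  flat01 l a f <-> forall m, le_order m l -> vanish01 m a (derive01 f).
Proof.
split=> [fl m ml j jm|fl [//|j] _ jl].
  have := fl j.+1 isT; rewrite /derive01n iterSr; apply.
  by case: l ml {fl} => //= n; exact: leq_trans.
by rewrite /derive01n iterSr; exact: fl jl _ (ltnSn j).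
Qed.

Lemma flat01M l a f g : a \in I -> smooth01 f -> smooth01 g ->
  flat01 l a f -> flat01 l a g -> flat01 l a (f \* g).
Proof.
move=> aI fs gs /flat01P fl /flat01P gl; apply/flat01P => m ml.
have [f's g's] := (smooth01_derive fs, smooth01_derive gs).
apply: (eq_vanish01 aI (f := derive01 f \* g \+ f \* derive01 g)).
  by move=> x xI; rewrite derive01M.
apply: (vanish01D aI (smooth01M f's gs) (smooth01M fs g's)).
  exact: vanish01Ml aI f's gs (fl m ml).
exact: vanish01Mr aI fs g's (gl m ml).
Qed.

Lemma flat01_comp l a f g : a \in I -> set_fun `[0, 1] `[0, 1] g ->
  smooth01 f -> smooth01 g -> flat01 l a g -> flat01 l a (f \o g).
Proof.
move=> aI g01 fs gs /flat01P gl; apply/flat01P => m ml.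
have [f's g's] := (smooth01_derive fs, smooth01_derive gs).
apply: (eq_vanish01 aI (f := (derive01 f \o g) \* derive01 g)).
  by move=> x xI; rewrite derive01_comp.
exact: vanish01Mr aI (smooth01_comp g01 f's gs) g's (gl m ml).
Qed.

End UnitIntervalCalculusTheory.

(** * Smooth step functions *)

Lemma smooth_stepM (R : realType) (l r : order_ext) (f g : R -> R) :
  smooth_step l r f -> smooth_step l r g -> smooth_step l r (f \* g).
Proof.
move=> [f01 fi fs f0 f1 fl fr] [g01 gi gs g0 g1 gl gr]; split.
- move=> x xI /=; have := f01 x xI; have := g01 x xI; rewrite /= !in_itv /=.
  by move=> /andP[? ?] /andP[? ?]; rewrite mulr_ge0 //= mulr_ile1.
- move=> x y xI yI xy /=.
  have /= := f01 x xI; have /= := g01 x xI; rewrite !in_itv /=.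
  move=> /andP[gx0 _] /andP[fx0 _].
  by apply: ltr_pM => //; [exact: fi|exact: gi].
- exact: smooth01M.
- by rewrite /= f0 mul0r.
- by rewrite /= f1 mul1r.
- by apply: flat01M fs gs fl gl; rewrite in_itv /= lexx ler01.
- by apply: flat01M fs gs fr gr; rewrite in_itv /= lexx ler01.
Qed.

Lemma smooth_step_comp (R : realType) (l r : order_ext) (f g : R -> R) :
  smooth_step l r f -> smooth_step l r g -> smooth_step l r (f \o g).
Proof.
move=> [f01 fi fs f0 f1 _ _] [g01 gi gs g0 g1 gl gr]; split.
- by move=> x xI; apply: f01; exact: g01.
- by move=> x y xI yI xy; apply: fi; [exact: g01|exact: g01|exact: gi].
- exact: smooth01_comp.
- by rewrite /= g0.
- by rewrite /= g1.
- by apply: flat01_comp g01 fs gs gl; rewrite in_itv /= lexx ler01.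
- by apply: flat01_comp g01 fs gs gr; rewrite in_itv /= lexx ler01.
Qed.

Theorem theorem5 (R : realType) (l r : order_ext) :
  (forall f g : R -> R,
     Sigma l r f -> Sigma l r g -> Sigma l r (f \* g)) /\
  (forall f g : R -> R,
     Sigma l r f -> Sigma l r g -> Sigma l r (f \o g)).
Proof.
by split=> f g; [exact: smooth_stepM|exact: smooth_step_comp].
Qed.
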